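(* Let $n,d_1,\dots,d_n$ be positive integers and let $P=\{1,\dots,d_1\}\times\cdots\times\{1,\dots,d_n\}$ be equipped with the product order. For arbitrary $C_i\in\mathbb{C}^{d_i\times d_i}$, $i=1,\dots,n$, we have $$C_1\otimes\cdots\otimes C_n\in\overline{\mathcal{L}(P)\,\mathcal{U}(P)}.$$
   Context: The product order on $P$ is $(x_1,\dots,x_n)\le(y_1,\dots,y_n)$ iff $x_i\le y_i$ for all $i$, with the usual order on each $\{1,\dots,d_i\}$. The tensor product $C_1\otimes\cdots\otimes C_n$ is regarded as the matrix in $\mathbb{C}^{P\times P}$ with entries $(C_1\otimes\cdots\otimes C_n)_{x,y}=\prod_{i=1}^n(C_i)_{x_i,y_i}$. For a finite poset $P$, $$\mathcal{L}(P):=\{L\in\mathbb{C}^{P\times P}\mid L_{xy}=0\text{ unless }y\le x\},\qquad \mathcal{U}(P):=\{U\in\mathbb{C}^{P\times P}\mid U_{xy}=0\text{ unless }x\le y\},$$ $\mathcal{L}(P)\,\mathcal{U}(P)=\{LU\mid L\in\mathcal{L}(P),U\in\mathcal{U}(P)\}$, and the bar denotes the closure in the norm topology. *)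

(* Defs.v *)
From HB Require Import structures.
From mathcomp Require Import all_boot all_order all_algebra.
From mathcomp Require Import boolp classical_sets reals topology normedtype.
From mathcomp Require Import complex.

Set Implicit Arguments.
Unset Strict Implicit.
Unset Printing Implicit Defensive.

Import Order.TTheory GRing.Theory Num.Theory.
Import numFieldNormedType.Exports.

Local Open Scope classical_set_scope.
Local Open Scope ring_scope.

(* The complex numbers, packed as a numClosedFieldType: the norm topology that
   MathComp-Analysis puts on every numFieldType K is found by unification on
   the sort of K, hence on (Cplx R) and 'M[Cplx R]_n, but not on bare R[i]. *)
Definition Cplx (R : realType) : numClosedFieldType := R[i]%C.

(* {1, ..., d_i} is encoded as 'I_(d i) = {0, ..., d_i - 1}. *)
Definition box (n : nat) (d : 'I_n -> nat) : Type :=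
  {dffun forall i : 'I_n, 'I_(d i)}.

Fact box_display : Order.disp_t. Proof. exact: Order.Disp tt tt. Qed.

Section BoxOrder.
Variables (n : nat) (d : 'I_n -> nat).

HB.instance Definition _ := Finite.copy (box d) {dffun forall i : 'I_n, 'I_(d i)}.

Definition box_le (x y : box d) : bool := [forall i, (x i <= y i)%O].

Fact box_le_refl : reflexive box_le.
Proof. by move=> x; apply/forallP => i. Qed.

Fact box_le_anti : antisymmetric box_le.
Proof.
move=> x y /andP[/forallP xy /forallP yx].
by apply/ffunP => i; apply/le_anti; rewrite xy yx.
Qed.

Fact box_le_trans : transitive box_le.
Proof.
move=> y x z /forallP xy /forallP yz; apply/forallP => i.
exact: le_trans (xy i) (yz i).
Qed.

HB.instance Definition _ :=
  Order.Le_isPOrder.Build box_display (box d)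
    box_le_refl box_le_anti box_le_trans.

End BoxOrder.

(* A matrix with rows and columns indexed by a finite type P is an element of
   'M_#|{: P}|, read through the bijection enum_rank : P -> 'I_#|P|. *)
Definition entry (K : Type) (P : finType) (M : 'M[K]_#|{: P}|) (x y : P) : K :=
  M (enum_rank x) (enum_rank y).

Definition lowerP (K : pzRingType) disp (P : finPOrderType disp) :
    set 'M[K]_#|{: P}| :=
  [set L | forall x y : P, ~~ (y <= x)%O -> entry L x y = 0].
Arguments lowerP K {disp} P.

Definition upperP (K : pzRingType) disp (P : finPOrderType disp) :
    set 'M[K]_#|{: P}| :=
  [set U | forall x y : P, ~~ (x <= y)%O -> entry U x y = 0].
Arguments upperP K {disp} P.

Definition luP (K : pzRingType) disp (P : finPOrderType disp) :
    set 'M[K]_#|{: P}| :=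
  [set L *m U | L in lowerP K P & U in upperP K P].
Arguments luP K {disp} P.

Definition of_entries (K : Type) (P : finType) (f : P -> P -> K) :
    'M[K]_#|{: P}| :=
  \matrix_(a, b) f (enum_val a) (enum_val b).

Fact of_entriesE (K : Type) (P : finType) (f : P -> P -> K) (x y : P) :
  entry (of_entries f) x y = f x y.
Proof. by rewrite /entry mxE !enum_rankK. Qed.

Definition tensor (K : comPzRingType) (n : nat) (d : 'I_n -> nat)
    (C : forall i : 'I_n, 'M[K]_(d i)) : 'M[K]_#|{: box d}| :=
  of_entries (fun x y : box d => \prod_(i < n) C i (x i) (y i)).

(* Main.v *)
(* Each [C i + t I] has an LU factorisation for all small [t != 0]: bordering a
   leading block that is invertible and already factored extends the
   factorisation by one row and column, and invertibility fails only at the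
   finitely many roots of a characteristic polynomial.  As the tensor product is
   multiplicative and sends triangular factors to [lowerP] and [upperP], the
   tensor product of the [C i + t I] lies in [luP]; now let [t] tend to [0]. *)
Require Import Defs.
From mathcomp Require Import all_boot all_order all_algebra.
From mathcomp Require Import boolp classical_sets reals topology normedtype.
From mathcomp Require Import complex.
Import numFieldNormedType.Exports.

Set Implicit Arguments.
Unset Strict Implicit.
Unset Printing Implicit Defensive.
Import Order.TTheory GRing.Theory Num.Theory.
Local Open Scope classical_set_scope.
Local Open Scope ring_scope.

Lemma continuous_horner (K : numFieldType) (p : {poly K}) :
  continuous (fun t : K => p.[t]).
Proof.
elim/poly_ind: p => [|p c IH] a.
  have -> : horner 0 = fun=> 0 :> K by apply/funext => t; rewrite horner0.
  exact: cst_continuous.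
have -> : horner (p * 'X + c%:P) = fun t => p.[t] * t + c.
  by apply/funext => t; rewrite hornerMXaddC.
exact: (cvgD (cvgM (IH a) cvg_id) (@cvg_cst _ _ _ _ _)).
Qed.

Lemma near_horner_neq0 (K : numFieldType) (p : {poly K}) (a : K) :
  p != 0 -> \forall t \near a^', p.[t] != 0.
Proof.
move=> p0; have [m [q qa ->]] := multiplicity_XsubC p a.
have {}qa : q.[a] != 0 by move: qa; rewrite p0.
have qt : \forall t \near a^', q.[t] != 0.
  by apply: nbhs_dnbhs; exact: (cvgr_neq0 _ (@continuous_horner _ q a) qa).
near=> t; rewrite hornerM horner_exp hornerXsubC mulf_neq0//.
  by near: t.
by rewrite expf_neq0// subr_eq0; near: t; exact: nbhs_dnbhs_neq.
Unshelve. all: by end_near. Qed.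

Lemma near_addr_scalar_unit (K : numFieldType) (n : nat) (A : 'M[K]_n) :
  \forall t \near (0 : K)^', A + t%:M \in unitmx.
Proof.
have /near_horner_neq0-/(_ 0) := monic_neq0 (char_poly_monic (- A)).
apply: filterS => t.
rewrite unitmxE unitfE /char_poly -horner_evalE -det_map_mx.
congr (\det _ != 0); apply/matrixP => i j; rewrite !mxE /= horner_evalE.
by rewrite hornerD hornerN hornerC hornerMn hornerX opprK addrC.
Qed.

Lemma near_addr_scalar_LU (K : numFieldType) (n : nat) (A : 'M[K]_n) :
  \forall t \near (0 : K)^', exists LU : 'M[K]_n * 'M[K]_n,
    [/\ is_trig_mx LU.1, is_trig_mx LU.2^T & A + t%:M = LU.1 *m LU.2].
Proof.
elim: n A => [|n IH]; last rewrite -addn1.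
  move=> A; near=> t; exists (0, 0).
  by split; rewrite /= ?trmx0 ?mx0_is_trig ?flatmx0 ?[RHS]flatmx0.
move=> A; have := IH (ulsubmx A); have := near_addr_scalar_unit (ulsubmx A).
apply: filterS2 => t Bu [[L U] [/= Lt Ut BLU]].
move: Bu; rewrite BLU unitmx_mul => /andP[Lu Uu].
exists (block_mx L 0 (dlsubmx A *m invmx U) 1%:M,
        block_mx U (invmx L *m ursubmx A) 0
          (drsubmx A + t%:M - dlsubmx A *m invmx U *m (invmx L *m ursubmx A))).
split=> /=.
- by rewrite is_trig_block_mx// eqxx Lt scalar_mx_is_trig.
- by rewrite tr_block_mx is_trig_block_mx// trmx0 eqxx Ut mx11_is_trig.
- rewrite mulmx_block !mul0mx !mulmx0 !mul1mx !addr0 -BLU mulKVmx// mulmxKV//.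
  rewrite [X in block_mx _ _ _ X]addrC subrK scalar_mx_block.
  by rewrite -{1}[A]submxK add_block_mx !addr0.
Unshelve. all: by end_near. Qed.

Lemma prod_sum_dffun (K : comPzRingType) (n : nat) (d : 'I_n -> nat)
    (F : forall i, 'I_(d i) -> K) :
  \prod_(i < n) \sum_(k < d i) F i k = \sum_(z : box d) \prod_(i < n) F i (z i).
Proof.
rewrite (reindex (@dffun_of_fprod _ (fun i => 'I_(d i)))); last first.
  exact/onW_bij/dffun_of_fprod_bij.
under [LHS]eq_bigr => i _ do rewrite (@big_tag _ _ _ _ (fun i => 'I_(d i)) F).
rewrite bigA_distr_big_dep.
transitivity (\sum_(t : fprod (fun i => 'I_(d i))) \prod_(i < n)
    [ffun k => F i k] (t i)).
  rewrite big_fprod; apply: eq_bigr => g _; apply: eq_bigr => i _.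
  by rewrite /untag; case: eqP => //= e; rewrite ffunE.
by apply: eq_bigr => t _; apply: eq_bigr => i _; rewrite !ffunE.
Qed.

Lemma tensor_mulmx (K : comPzRingType) (n : nat) (d : 'I_n -> nat)
    (A B : forall i : 'I_n, 'M[K]_(d i)) :
  tensor (fun i => A i *m B i) = tensor A *m tensor B.
Proof.
apply/matrixP => a b; rewrite !mxE.
under eq_bigr do rewrite mxE.
rewrite prod_sum_dffun [RHS](reindex (@enum_rank (box d))); last first.
  exact/onW_bij/enum_rank_bij.
by apply: eq_bigr => z _; rewrite !mxE enum_rankK -big_split.
Qed.

Lemma box_nle (n : nat) (d : 'I_n -> nat) (x y : box d) :
  ~~ (x <= y)%O -> exists i, (y i < x i)%N.
Proof.
rewrite -[(x <= y)%O]/[forall i, (x i <= y i)%O] negb_forall.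
by move=> /existsP[k]; rewrite -ltNge; exists k.
Qed.

Lemma tensor_lowerP (K : comPzRingType) (n : nat) (d : 'I_n -> nat)
    (L : forall i : 'I_n, 'M[K]_(d i)) :
  (forall i, is_trig_mx (L i)) -> lowerP K (box d) (tensor L).
Proof.
move=> Lt x y /box_nle[k xy]; rewrite of_entriesE (bigD1 k)//=.
by rewrite (is_trig_mxP (Lt k)) ?mul0r.
Qed.

Lemma tensor_upperP (K : comPzRingType) (n : nat) (d : 'I_n -> nat)
    (U : forall i : 'I_n, 'M[K]_(d i)) :
  (forall i, is_trig_mx (U i)^T) -> upperP K (box d) (tensor U).
Proof.
move=> Ut x y /box_nle[k yx]; rewrite of_entriesE (bigD1 k)//=.
by rewrite -[U k]trmxK mxE (is_trig_mxP (Ut k)) ?mul0r.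
Qed.

Lemma cvg_tensor_add_scalar (K : numFieldType) (n : nat) (d : 'I_n -> nat)
    (C : forall i : 'I_n, 'M[K]_(d i)) :
  tensor (fun i => C i + t%:M) @[t --> (0 : K)] --> tensor C.
Proof.
have cvgC i u v : C i u v + t *+ (u == v) @[t --> (0 : K)] --> C i u v.
  rewrite -[X in _ --> X]addr0 -[X in _ + X](mul0rn _ (u == v)).
  apply: (@cvgD _ _ _ (nbhs (0 : K))); [exact: cvg_cst|].
  exact: (@cvgMn _ _ _ _ _ id _ _ cvg_id).
move=> B [P PM PB].
have nP a b : \forall t \near (0 : K), P a b (tensor (fun i => C i + t%:M) a b).
  suff : (tensor (fun i => C i + t%:M)) a b @[t --> (0 : K)] --> tensor C a b.
    by apply; exact: PM.
  under [X in X @ _]funext => t do rewrite mxE.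
  rewrite mxE.
  apply: (@cvg_big _ _ _ _ _ _ _ (nbhs (0 : K))) => [|i _].
    exact: mul_continuous.
  under [X in X @ _]funext => t do rewrite !mxE.
  exact: cvgC.
apply: (@filterS _ (nbhs (0 : K)) _ _ _ (fun t => PB _)).
apply: (@filter_forall _ _ _ (nbhs (0 : K))) => a.
apply: (@filter_forall _ _ _ (nbhs (0 : K))) => b; exact: nP.
Qed.

Theorem lemma4 (R : realType) (n : nat) (d : 'I_n -> nat)
  (hn : (0 < n)%N) (hd : forall i : 'I_n, (0 < d i)%N)
  (C : forall i : 'I_n, 'M[Cplx R]_(d i)) :
  closure (luP (Cplx R) (box d)) (tensor C).
Proof.
move=> B /cvg_tensor_add_scalar/nbhs_dnbhs nB.
have /filter_ex[t [Bt exLU]] : \forall t \near (0 : Cplx R)^',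
    B (tensor (fun i => C i + t%:M)) /\ forall i : 'I_n,
    exists LU : 'M[Cplx R]_(d i) * 'M[Cplx R]_(d i),
    [/\ is_trig_mx LU.1, is_trig_mx LU.2^T & C i + t%:M = LU.1 *m LU.2].
  apply: filterI => //.
  apply: (@filter_forall _ _ _ (dnbhs (0 : Cplx R))) => i.
  exact: near_addr_scalar_LU.
pose LU i := cid (exLU i).
exists (tensor (fun i => C i + t%:M)); split=> //.
exists (tensor (fun i => (sval (LU i)).1)).
  by apply: tensor_lowerP => i; have [] := svalP (LU i).
exists (tensor (fun i => (sval (LU i)).2)).
  by apply: tensor_upperP => i; have [] := svalP (LU i).
rewrite -tensor_mulmx; congr tensor.
apply: functional_extensionality_dep => i.
by have [_ _ <-] := svalP (LU i).
Qed.
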